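(* Let $(Y,X,D)$ be random with $Y\in\mathbb R$, $X\in\mathbb R^p$, $D\in\{0,1\}$, and consider the linear regression model $Y=\alpha+\beta D+s(X)'\gamma+E$. Let $Z=(1,D,s(X)')'$, and suppose that $\mathbf E[\|Z\|^2]$ and $\mathbf E[\|ZE\|]$ are finite, $\mathbf E[ZZ']$ is positive definite, and $\mathbf E[ZE]=\mathbf 0$. Then $$\beta-\tau=\int \bigl(f(x,0)-l_\theta^s(x,0)\bigr)\bigl(g^1(x)-g^0(x)\bigr)\,\mu(\mathrm dx),$$ where $(g^1(x)-g^0(x))\mu(\mathrm dx)=(G^1-G^0)(\mathrm dx)$.
   Context: For $d\in\{0,1\}$, $G^d$ is the conditional distribution of $X$ given $D=d$, with support $\mathcal X^d\subseteq\mathbb R^p$; $\mu$ is a ($\sigma$-finite) measure dominating both $G^1$ and $G^0$, and $g^d=\mathrm dG^d/\mathrm d\mu$. $F$ is the conditional distribution of $Y$ given $(X',D)'$, regarded as a given kernel defined for $(x,d)\in(\mathcal X^0\cup\mathcal X^1)\times\{0,1\}$, and $f(x,d)=\mathbf E[Y|X=x,D=d]$ is its mean. The parameter of interest is $$\tau=\mathbf E[Y|D=1]-\mathbf E[\mathbf E[Y|X,D=0]|D=1]=\mathbf E[Y|D=1]-\int f(x,0)\,G^1(\mathrm dx),$$ assumed to be well defined (i.e. $f(\cdot,0)$ is $G^1$-integrable). $s$ is a measurable map from $\mathbb R^p$ to a finite-dimensional Euclidean space, $\theta=(\alpha,\beta,\gamma')'$, and $l_\theta^s(x,d)=\alpha+\beta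 d+s(x)'\gamma$. *)

(* Defs.v *)
From HB Require Import structures.
From mathcomp Require Import all_boot all_order all_algebra.
From mathcomp Require Import all_classical all_reals all_analysis.
From mathcomp Require Import measurable_realfun.

Set Implicit Arguments.
Unset Strict Implicit.
Unset Printing Implicit Defensive.

Import Order.TTheory GRing.Theory Num.Theory.
Import numFieldNormedType.Exports.

Local Open Scope classical_set_scope.
Local Open Scope ring_scope.

(* R^n is [n.-tuple R]: the library equips it with the product sigma-algebra,
   which is the Borel one. *)

Section linear_algebra.
Context {R : realType} {n : nat}.

(* The norm [`|v|] of the library on matrices is the sup norm. *)
Definition enorm (v : 'cV[R]_n) : R := Num.sqrt (\sum_(i < n) v i 0 ^+ 2).

Definition positive_definite (M : 'M[R]_n) : Prop :=
  M^T = M /\ forall v : 'cV[R]_n, v != 0 -> 0 < (v^T *m M *m v) 0 0.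

Definition col_of_tuple (t : n.-tuple R) : 'cV[R]_n := \col_i tnth t i.

End linear_algebra.

(* Entrywise expectation. The use of [fine] is meaningful only when the entries
   are integrable. *)
Definition mexpectation {d} {T : measurableType d} {R : realType}
    (P : probability T R) {m n : nat} (M : T -> 'M[R]_(m, n)) : 'M[R]_(m, n) :=
  \matrix_(i, j) fine ('E_P[fun w => M w i j])%E.

Section conditioning.
Context {d} {T : measurableType d} {R : realType}.
Variables (P : probability T R) (D : {RV P >-> bool}).

Lemma measurable_event (b : bool) : measurable (D @^-1` [set b]).
Proof. by rewrite -[X in measurable X]setTI; exact: measurable_funP. Qed.

(* A |-> P (A /\ D = b) / P (D = b). [mnormalize] falls back on its second
   argument, here P itself, when P (D = b) = 0. *)
Definition cond_prob (b : bool) : probability T R :=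
  mnormalize (mrestr P (measurable_event b)) P.

Definition cond_distribution {d'} {T' : measurableType d'} (X : {RV P >-> T'})
    (b : bool) : probability T' R :=
  distribution (cond_prob b) X.

End conditioning.

Definition open_cube {R : realType} {p : nat} (x : p.-tuple R) (e : R) :
    set (p.-tuple R) :=
  [set y | forall i, `|tnth y i - tnth x i| < e].

(* Topological support: the points all of whose neighbourhoods have positive
   mass. The open cubes centred at x form a basis of neighbourhoods of x. *)
Definition support_of {R : realType} {p : nat}
    (G : probability (p.-tuple R) R) : set (p.-tuple R) :=
  [set x | forall e : R, 0 < e -> (0 < G (open_cube x e))%E].

Section pair.
Context {d d1 d2 : measure_display} {T : measurableType d}.
Context {T1 : measurableType d1} {T2 : measurableType d2}.
Variables (X1 : {mfun T >-> T1}) (X2 : {mfun T >-> T2}).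

Definition pair_RV (w : T) : T1 * T2 := (X1 w, X2 w).

Let measurable_pair_RV : measurable_fun setT pair_RV.
Proof. by apply: measurable_fun_pair. Qed.

HB.instance Definition _ :=
  isMeasurableFun.Build _ _ _ _ pair_RV measurable_pair_RV.

End pair.

Section conditional_law.
Context {d} {T : measurableType d} {R : realType} (P : probability T R).
Context {d'} {U : measurableType d'}.

(* F is a probability kernel on the measurable set [dom] which is a regular
   conditional distribution of Y given W. The values of F outside [dom] are
   arbitrary; at points of [dom] that W does not charge, F is only subject to
   the measurability requirement. *)
Definition cond_law_on (dom : set U) (F : U -> probability R R)
    (Y : {RV P >-> R}) (W : {RV P >-> U}) : Prop :=
  (forall B : set R, measurable B ->
     measurable_fun dom (F ^~ B)) /\
  (forall (A : set U) (B : set R), measurable A -> measurable B ->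
     P (W @^-1` A `&` Y @^-1` B) =
     (\int[distribution P W]_(u in A `&` dom) F u B)%E).

End conditional_law.

(* Extended-real valued: it is a real number if and only if the identity is
   (F u)-integrable, because (+oo) - (+oo) = -oo in [\bar R]. *)
Definition cond_mean {R : realType} {U : Type} (F : U -> probability R R)
    (u : U) : \bar R :=
  (\int[F u]_y y%:E)%E.

(* g is a (real-valued) version of dG/dmu. *)
Definition RN_version {d} {T : measurableType d} {R : realType}
    (G : probability T R) (mu : {sigma_finite_measure set T -> \bar R})
    (g : T -> R) : Prop :=
  measurable_fun setT g /\
  ae_eq mu setT (EFin \o g) (Radon_Nikodym (charge_of_finite_measure G) mu).

Section linear_model.
Context {R : realType} {p k : nat}.
Variable s : p.-tuple R -> k.-tuple R.

Definition linpred (alpha beta : R) (gamma : 'cV[R]_k)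
    (x : p.-tuple R) (b : bool) : R :=
  alpha + beta * b%:R + ((col_of_tuple (s x))^T *m gamma) 0 0.

(* The column vector (1, b, s(x)')'. *)
Definition regressor (x : p.-tuple R) (b : bool) : 'cV[R]_(1 + (1 + k)) :=
  col_mx 1%:M (col_mx (b%:R)%:M (col_of_tuple (s x))).

End linear_model.

Section estimand.
Context {d} {T : measurableType d} {R : realType} {p : nat}.
Variables (P : probability T R).
Variables (Y : {RV P >-> R}) (X : {RV P >-> p.-tuple R}) (D : {RV P >-> bool}).
Variable F : p.-tuple R * bool -> probability R R.

Definition covariate_support : set (p.-tuple R) :=
  support_of (cond_distribution D X false) `|`
  support_of (cond_distribution D X true).

(* E[Y | D = 1] - E[E[Y | X, D = 0] | D = 1]. The inner expectation need not be
   determined by the law of (Y, X, D) where the law of X given D = 0 has no mass,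
   hence it is read off the kernel F. *)
Definition tau : \bar R :=
  ('E_(cond_prob D true)[Y] -
   \int[cond_distribution D X true]_(x in covariate_support)
     cond_mean F (x, false))%E.

End estimand.

(* Main.v *)
Require Import Defs.
From HB Require Import structures.
From mathcomp Require Import all_boot all_order all_algebra.
From mathcomp Require Import all_classical all_reals all_analysis.
From mathcomp Require Import measurable_realfun.
From mathcomp Require Import lra.
Import Order.TTheory GRing.Theory Num.Theory.
Import numFieldNormedType.Exports.
Local Open Scope classical_set_scope.
Local Open Scope ring_scope.

(* Positive definiteness of E[ZZ'] makes both events D = 0 and D = 1 charged,
   and the first two rows of E[ZE] = 0 then say that E has mean zero
   conditionally on each of them. Hence E[Y|D=b] = \int l(x,0) dG^b + beta b.
   For b = 0, disintegrating the law of Y along F also gives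
   E[Y|D=0] = \int f(x,0) dG^0, so that f(.,0) - l(.,0) has G^0-integral 0; for
   b = 1, beta - tau is its G^1-integral. The difference of these two integrals
   is the right-hand side, by change of variables to mu. The domain of F has full
   mass because its complement is covered by countably many null rational
   cubes. *)

(** * Topological supports are measurable and of full mass *)

Section support.
Context {R : realType} {p : nat}.

Lemma measurable_open_cube (x : p.-tuple R) (e : R) :
  measurable (open_cube x e).
Proof.
have -> : open_cube x e =
    \bigcap_(i in [set: 'I_p]) ((@tnth p R)^~ i @^-1` ball (tnth x i) e).
  apply/seteqP; split=> [y xy i _|y xy i]; first by rewrite /ball/= distrC.
  by have := xy i I; rewrite /ball/= distrC.
apply: fin_bigcap_measurable; first exact: finite_finset.
move=> i _; rewrite -[X in measurable X]setTI.
by apply: measurable_tnth => //; exact: measurable_ball.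
Qed.

(** A rational centre within [e / 4] of [x] in each coordinate and a rational radius strictly
    between [e / 4] and [e / 2] work: the radius exceeds the distance to [x], and a point of the
    rational cube is at distance less than [e / 2 + e / 4] from [x]. *)
Lemma open_cube_rat (x : p.-tuple R) (e : R) : 0 < e ->
  exists (q : p.-tuple rat) (r : rat),
    open_cube (map_tuple ratr q) (ratr r) x /\
    open_cube (map_tuple ratr q) (ratr r) `<=` open_cube x e.
Proof.
move=> e0.
have /rat_in_itvoo[r] : e / 4 < e / 2 by lra.
rewrite in_itv/= => /andP[er re].
have /choice[c cP] (i : 'I_p) : exists c : rat, `|tnth x i - ratr c| < e / 4.
  have /rat_in_itvoo[c] : tnth x i - e / 4 < tnth x i + e / 4 by lra.
  rewrite in_itv/= => /andP[xc cx]; exists c.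
  by rewrite ltr_norml; apply/andP; split; lra.
exists [tuple c i | i < p], r; split=> [i|y yc i].
  by rewrite tnth_map tnth_mktuple; apply: lt_trans (cP i) _.
have := yc i; have := cP i; rewrite tnth_map tnth_mktuple => cx cy.
have -> : tnth y i - tnth x i =
  (tnth y i - ratr (c i)) - (tnth x i - ratr (c i)) by lra.
by apply: le_lt_trans (ler_normB _ _) _; lra.
Qed.

Lemma open_cube_sub (c x : p.-tuple R) (r : R) : open_cube c r x ->
  exists2 e, 0 < e & open_cube x e `<=` open_cube c r.
Proof.
move=> cx.
(* The smallest slack over the coordinates; the default 1 keeps it positive when [p = 0]. *)
pose m := \big[Num.min/1%R]_(i < p) (r - `|tnth x i - tnth c i|).
exists m; first by apply/lt_bigmin => // i _; rewrite subr_gt0; exact: cx.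
move=> y xy i; have := xy i.
have : m <= r - `|tnth x i - tnth c i| by exact: bigmin_le_cond.
have -> : tnth y i - tnth c i =
  (tnth y i - tnth x i) + (tnth x i - tnth c i) by lra.
by move=> h1 h2; apply: le_lt_trans (ler_normD _ _) _; lra.
Qed.

Variable G : probability (p.-tuple R) R.

(** An enumeration of the null rational cubes by their pickling codes. Codes of charged cubes and
    codes that decode to nothing give the empty set, so every term is null. *)
Let null_cube (n : nat) : set (p.-tuple R) :=
  if unpickle n is Some (q, r) then
    let A := open_cube (map_tuple ratr (q : p.-tuple rat)) (ratr (r : rat)) in
    if G A == 0%E then A else set0
  else set0.

Let measurable_null_cube n : measurable (null_cube n).
Proof.
rewrite /null_cube; case: unpickle => [[q r]|//].
by case: ifPn => // _; exact: measurable_open_cube.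
Qed.

Let null_cube0 n : G (null_cube n) = 0%E.
Proof.
rewrite /null_cube; case: unpickle => [[q r]|]; last by rewrite measure0.
by case: ifPn => [/eqP //|_]; rewrite measure0.
Qed.

(** A point off the support is the centre of a null cube, and [open_cube_rat] puts a rational cube
    around the point inside it. Conversely, a point of a null rational cube is the centre of a
    smaller cube inside it, which is null as well. *)
Let setC_support_of : ~` support_of G = \bigcup_n null_cube n.
Proof.
apply/seteqP; split=> [x /existsNP[e /not_implyP[e0 /negP]]|x [n _]].
  rewrite lt_neqAle measure_ge0 andbT negbK => /eqP Ge.
  have [q [r [qx qe]]] := open_cube_rat x _ e0.
  exists (pickle (q, r)) => //; rewrite /null_cube pickleK ifT//.
  rewrite eq_le measure_ge0 andbT Ge; apply: le_measure => //;
    by rewrite inE; exact: measurable_open_cube.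
rewrite /null_cube; case: unpickle => [[q r]|//].
case: ifPn => // /eqP G0 /open_cube_sub[e e0 eq] /(_ _ e0).
rewrite ltNge => /negP; apply; rewrite -G0.
by apply: le_measure => //; rewrite inE; exact: measurable_open_cube.
Qed.

Lemma measurable_support_of : measurable (support_of G).
Proof.
by rewrite -[support_of G]setCK; apply: measurableC; rewrite setC_support_of;
  exact: bigcupT_measurable.
Qed.

Lemma setC_support_of0 : G (~` support_of G) = 0%E.
Proof.
apply: measure_negligible; first by apply: measurableC; exact: measurable_support_of.
rewrite setC_support_of; apply: negligible_bigcup => n.
by apply/negligibleP; [exact: measurable_null_cube|exact: null_cube0].
Qed.

End support.

(** * Integration against a mixture of a kernel defined on a subset *)

Section disintegration.
Context {d} {U : measurableType d} {R : realType}.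
Variables (m : {finite_measure set U -> \bar R}) (dom : set U).
Variable F : U -> probability R R.
Hypothesis mdom : measurable dom.
Hypothesis mF : forall B, measurable B -> measurable_fun dom (F ^~ B).

(** [F] extended by the zero measure off [dom], which makes it measurable everywhere. The dummy
    [unit] factor is the source of the constant kernel [L] with which [K] is composed. *)
Let K (u : unit * U) : {measure set R -> \bar R} :=
  if u.2 \in dom then (F u.2 : {measure set R -> \bar R}) else mzero.

Let K_E B : K ^~ B = ((F ^~ B) \_ dom) \o snd.
Proof. by apply/funext => u; rewrite /K /patch/=; case: ifP. Qed.

Let measurable_K B : measurable B -> measurable_fun [set: unit * U] (K ^~ B).
Proof.
move=> mB; rewrite K_E; apply: measurableT_comp => //.
by move/(measurable_restrictT _ mdom): (mF B mB).
Qed.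

HB.instance Definition _ := isKernel.Build _ _ _ _ _ K measurable_K.

Let K_uub : measure_fam_uub K.
Proof.
(* The uniform bound has to be strict, hence 2 for measures of mass at most 1. *)
exists 2%R => u; rewrite /K; case: ifP => _; last by rewrite /mzero lte_fin.
by apply: (@le_lt_trans _ _ 1%E); [exact: probability_le1|rewrite lte_fin ltr1n].
Qed.

HB.instance Definition _ := Kernel_isFinite.Build _ _ _ _ _ K K_uub.

Let L (_ : unit) : {measure set U -> \bar R} := m.

Let measurable_L B : measurable B -> measurable_fun [set: unit] (L ^~ B).
Proof. by []. Qed.

HB.instance Definition _ := isKernel.Build _ _ _ _ _ L measurable_L.

Let L_uub : measure_fam_uub L.
Proof.
exists (fine (m setT) + 1) => u; rewrite /L EFinD fineK ?fin_num_measure//.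
by rewrite lteDl ?fin_num_measure// lte01.
Qed.

HB.instance Definition _ := Kernel_isFinite.Build _ _ _ _ _ L L_uub.

Variable h : R -> \bar R.
Hypothesis h0 : forall y, (0 <= h y)%E.
Hypothesis mh : measurable_fun setT h.

Lemma measurable_integral_on_kernel :
  measurable_fun dom (fun u => \int[F u]_y h y)%E.
Proof.
apply/(measurable_restrictT _ mdom).
have -> : (fun u => \int[F u]_y h y)%E \_ dom =
    (fun u => \int[K u]_y h y)%E \o (pair tt).
  apply/funext => u; rewrite /patch /K/=; case: ifP => // _.
  by rewrite integral_measure_zero.
apply: measurableT_comp; last exact: measurable_pair1.
by apply: measurable_fun_integral_kernel.
Qed.

(** The hypothesis says that [nu] agrees with the composition of the constant kernel [m] with [K],
    so the integration formula for composed kernels applies; off [dom] the inner integral is 0. *)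
Lemma disintegration (nu : {measure set R -> \bar R}) :
    (forall B, measurable B -> nu B = \int[m]_(u in dom) F u B)%E ->
  (\int[nu]_y h y = \int[m]_(u in dom) \int[F u]_y h y)%E.
Proof.
move=> nuE.
rewrite (eq_measure_integral (kcomp L K tt)); last first.
  move=> B mB _; rewrite nuE// /kcomp integral_mkcond.
  by apply: eq_integral => u _; exact/esym/(congr1 (@^~ (tt, u)) (K_E B)).
rewrite integral_kcomp//= [RHS]integral_mkcond.
apply: eq_integral => u _.
change (\int[K (tt, u)]_y h y = (fun u => \int[F u]_y h y) \_ dom u)%E.
rewrite /patch /K/=; case: ifP => // _.
by rewrite integral_measure_zero.
Qed.

End disintegration.

(** * Conditioning on the event [D = b] *)

Lemma cond_law_on_measurable {d} {T : measurableType d} {R : realType}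
    (P : probability T R) {d' d''} {U : measurableType d'}
    {V : measurableType d''} (dom : set U) (F : U * V -> probability R R)
    (Y : {RV P >-> R}) (W : {RV P >-> (U * V)%type}) :
    measurable dom -> cond_law_on (dom `*` [set: V]) F Y W ->
  forall B v, measurable B -> measurable_fun dom (fun x => F (x, v) B).
Proof.
move=> mdom [mF _] B v mB.
apply: (@measurable_comp _ _ _ _ _ _ (dom `*` [set: V]) (F ^~ B) _ (pair^~ v)).
- exact: measurableX.
- by move=> _ [x domx <-].
- exact: mF.
- exact: measurable_funTS (pair2_measurable v).
Qed.

Section cond_prob.
Context {d} {T : measurableType d} {R : realType}.
Variables (P : probability T R) (D : {RV P >-> bool}) (b : bool).
Hypothesis Db0 : P (D @^-1` [set b]) != 0%E.
Local Notation Db := (D @^-1` [set b]).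
Local Notation c := (fine (P Db))^-1.

Let c_ge0 : 0 <= c.
Proof. by rewrite invr_ge0 fine_ge0. Qed.

Lemma cond_probE A : cond_prob D b A = (c%:E * P (A `&` Db))%E.
Proof.
rewrite /cond_prob/= /mnormalize/= /mrestr setTI (negbTE Db0)/=.
have /fin_numPlt/andP[_ /lt_eqF ->] : P Db \is a fin_num.
  by apply: fin_num_measure; exact: measurable_event.
by rewrite muleC.
Qed.

(** For a charged event, [cond_prob] is [P] restricted to [Db] and scaled by [c]. The complement of
    [Db] is null for the restriction, so it can be removed from the domain. *)
Lemma ge0_integral_cond_prob A (f : T -> \bar R) :
    measurable A -> measurable_fun A f -> (forall x, A x -> (0 <= f x)%E) ->
  (\int[cond_prob D b]_(x in A) f x = c%:E * \int[P]_(x in A `&` Db) f x)%E.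
Proof.
move=> mA mf f0; have mDb := measurable_event D b.
rewrite (eq_measure_integral
  (mscale (NngNum c_ge0) (mrestr P mDb))); last first.
  by move=> B mB _; exact: cond_probE.
rewrite ge0_integral_mscale//; congr (_ * _)%E.
rewrite (@ge0_negligible_integral _ _ _ _ A (~` Db))//; last 2 first.
- exact: measurableC.
- by rewrite /= /mrestr setICl measure0.
rewrite setDE setCK; apply: eq_measure_integral => B mB BAD.
by rewrite /= /mrestr; congr (P _); apply/setIidPl => x /BAD[].
Qed.

Lemma integral_cond_prob (f : T -> \bar R) : P.-integrable setT f ->
  (\int[cond_prob D b]_x f x = c%:E * \int[P]_(x in Db) f x)%E.
Proof.
move=> intf; have mf := measurable_int _ intf.
have intfD : P.-integrable Db f.
  by apply: integrableS intf => //; exact: measurable_event.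
rewrite integralE ge0_integral_cond_prob//; last exact: measurable_funepos.
rewrite ge0_integral_cond_prob//; last exact: measurable_funeneg.
rewrite setTI [in RHS](integralE _ _ f) [RHS]muleBr//.
rewrite fin_num_adde_defr//; apply: integrable_fin_num => //.
  exact: measurable_event.
by apply: integrable_funepos => //; exact: measurable_event.
Qed.

Lemma integrable_cond_prob (f : T -> \bar R) :
  P.-integrable setT f -> (cond_prob D b).-integrable setT f.
Proof.
move=> intf; have mf := measurable_int _ intf.
have /integrableP[_ foo] : P.-integrable Db f.
  by apply: integrableS intf => //; exact: measurable_event.
apply/integrableP; split=> //.
rewrite ge0_integral_cond_prob//; last exact: measurableT_comp.
by rewrite setTI lte_mul_pinfty ?lee_fin.
Qed.

(** Passes from the joint conditional law given [(X, D)] to the law given [D = b]: the defining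
    identity is used on the sets whose second coordinate is [b], and both integrals are pulled back
    to [T], where [D w = b] on the common domain. *)
Lemma cond_law_cond_prob d' (U : measurableType d') (X : {RV P >-> U})
    (Y : {RV P >-> R}) (dom : set U) (F : U * bool -> probability R R) B :
    measurable dom -> cond_law_on (dom `*` [set: bool]) F Y (pair_RV X D) ->
    measurable B ->
  (distribution (cond_prob D b) Y B =
   \int[cond_distribution D X b]_(x in dom) F (x, b) B)%E.
Proof.
move=> mdom [mF lawF] mB.
have mFb := cond_law_on_measurable _ _ _ _ _ mdom (conj mF lawF) _ b mB.
have mb : measurable ([set: U] `*` [set b]) by exact: measurableX.
rewrite [RHS]ge0_integral_pushforward//.
rewrite ge0_integral_cond_prob; last 3 first.
- by rewrite -[X in measurable X]setTI; exact: measurable_funP.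
- apply: (@measurable_comp _ _ _ _ _ _ dom) => //.
    by move=> _ [x domx <-].
  exact: measurable_funTS.
- by [].
rewrite [LHS]cond_probE; congr (_ * _)%E.
have -> : Y @^-1` B `&` Db =
    pair_RV X D @^-1` ([set: U] `*` [set b]) `&` Y @^-1` B.
  by apply/seteqP; split=> w /= => [[]|[[]]].
rewrite lawF//.
rewrite ge0_integral_pushforward//; last 2 first.
- by apply: measurableI => //; exact: measurableX.
- apply: measurable_funS (mF _ mB) => //; exact: measurableX.
rewrite (_ : pair_RV X D @^-1` _ = X @^-1` dom `&` Db); last first.
  by apply/seteqP; split=> w /= => [[[_ ?] [? _]]|[]].
by apply: eq_integral => w; rewrite inE/= => -[_ <-].
Qed.

End cond_prob.

(** * Change of variables from [G] to the dominating measure *)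

Section radon_nikodym_version.
Context {d} {T : measurableType d} {R : realType}.
Variables (G : probability T R) (mu : {sigma_finite_measure set T -> \bar R}).
Variable g : T -> R.
Hypothesis Gmu : G `<< mu.
Hypothesis gE : RN_version G mu g.
Variables (A : set T) (h : T -> \bar R).
Hypothesis mA : measurable A.
Hypothesis hint : G.-integrable A h.

Let mh : measurable_fun A h := measurable_int _ hint.

Let mhg : measurable_fun A (fun x => h x * (g x)%:E)%E.
Proof.
by apply: emeasurable_funM => //; apply/measurable_EFinP;
  apply: measurable_funTS; exact: gE.1.
Qed.

Lemma RN_version_integrable : mu.-integrable A (fun x => h x * (g x)%:E)%E.
Proof.
apply/integrableP; split=> //.
(* The integrability of a product with the density is available for nonnegative factors, so it is
   applied to the absolute value of [h]; only absolute values matter for the conclusion. *)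
have /integrableP[mhf] := Radon_Nikodym_SigmaFinite.integrableM Gmu
  (fun x => abse_ge0 (h x)) mA (integrable_abse hint).
apply: le_lt_trans; rewrite le_eqVlt; apply/orP; left; apply/eqP.
apply: ae_eq_integral => //; try exact: measurableT_comp.
have fE := ae_eq_Radon_Nikodym_SigmaFinite Gmu measurableT.
have [_ gRN] := gE.
apply: filterS2 fE gRN => x /= fx gx Ax.
by rewrite gx// -fx// !abseM abse_id.
Qed.

Lemma RN_version_integral :
  (\int[mu]_(x in A) (h x * (g x)%:E) = \int[G]_(x in A) h x)%E.
Proof.
rewrite -(Radon_Nikodym_change_of_variables Gmu)//.
apply: ae_eq_integral => //.
  apply: emeasurable_funM => //; apply: measurable_funTS.
  exact/measurable_int/Radon_Nikodym_integrable.
have [_ gRN] := gE.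
by apply: filterS gRN => x /= gx Ax; rewrite gx.
Qed.

End radon_nikodym_version.

(** [h] is extended-real because it is to be instantiated with a function built on [cond_mean],
    which may be infinite at some points; distributivity over the difference of densities is then
    only an almost everywhere statement. *)
Lemma integral_RN_version_diff {d} {T : measurableType d} {R : realType}
    (G : bool -> probability T R) (mu : {sigma_finite_measure set T -> \bar R})
    (g : bool -> T -> R) (A : set T) (h : T -> \bar R) :
    (forall b, G b `<< mu) -> (forall b, RN_version (G b) mu (g b)) ->
    measurable A -> (forall b, (G b).-integrable A h) ->
  (\int[mu]_(x in A) (h x * (g true x - g false x)%:E) =
   \int[G true]_(x in A) h x - \int[G false]_(x in A) h x)%E.
Proof.
move=> Gmu gE mA hint.
have hgint b := RN_version_integrable _ _ _ (Gmu b) (gE b) _ _ mA (hint b).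
rewrite -!(RN_version_integral _ _ _ (Gmu _) (gE _) _ _ mA (hint _)).
rewrite -integralB//; apply: ae_eq_integral => //.
- apply: emeasurable_funM; first exact: measurable_int (hint true).
  apply/measurable_EFinP/measurable_funTS; apply: measurable_funB.
    exact: (gE true).1.
  exact: (gE false).1.
- by apply: measurable_int; exact: integrableB.
(* Where [h] is infinite, integrability forces both densities to vanish. *)
have fin_mul_infty (r : R) : (+oo * r%:E)%E \is a fin_num -> r = 0.
  by apply: contraTeq => r0; rewrite mulyr fin_num_abs abseM/=;
    rewrite normr_sg r0 mul1e.
apply: filterS2 (integrable_ae mA (hgint true))
  (integrable_ae mA (hgint false)) => x /= fin1 fin0 Ax.
move: {fin1 fin0} (fin1 Ax) (fin0 Ax); case: (h x) => [r _ _|g1 g0|].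
- by rewrite -!EFinM -EFinB mulrBr.
- by rewrite (fin_mul_infty _ g1) (fin_mul_infty _ g0) subr0 !mule0 sube0.
- rewrite -[-oo%E]/(- +oo)%E !mulNe !fin_numN => g1 g0.
  by rewrite (fin_mul_infty _ g1) (fin_mul_infty _ g0) subr0 !mule0 oppe0 sube0.
Qed.

(** * The regressor vector and the consequences of positive definiteness *)

Section regressor.
Context {d} {T : measurableType d} {R : realType} {p k : nat}.
Variables (P : probability T R) (X : {RV P >-> p.-tuple R}) (D : {RV P >-> bool}).
Variable s : {mfun p.-tuple R >-> k.-tuple R}.
Let Z w := regressor s (X w) (D w).

Lemma regressor1 x b : regressor s x b (lshift (1 + k) ord0) 0 = 1.
Proof. by rewrite /regressor col_mxEu mxE. Qed.

Lemma regressor_treatment x b :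
  regressor s x b (rshift 1 (lshift k ord0)) 0 = b%:R.
Proof. by rewrite /regressor col_mxEd col_mxEu mxE. Qed.

Lemma regressor_covariate x b j :
  regressor s x b (rshift 1 (rshift 1 j)) 0 = tnth (s x) j.
Proof. by rewrite /regressor !col_mxEd mxE. Qed.

Lemma measurable_treatment : measurable_fun setT (fun w => (D w)%:R : R).
Proof.
by apply: (measurableT_comp (f := fun b : bool => b%:R : R)).
Qed.

Lemma measurable_regressor i : measurable_fun setT (fun w => Z w i 0).
Proof.
rewrite /Z; case: (splitP i) => [j|j] ij.
  have -> : i = lshift (1 + k) ord0 by apply: val_inj; rewrite /= ij ord1.
  by under eq_fun do rewrite regressor1; exact: measurable_cst.
case: (splitP j) => l jl.
  have -> : i = rshift 1 (lshift k ord0).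
    by apply: val_inj; rewrite /= ij/= jl ord1.
  by under eq_fun do rewrite regressor_treatment; exact: measurable_treatment.
have -> : i = rshift 1 (rshift 1 l) by apply: val_inj; rewrite /= ij/= jl.
under eq_fun do rewrite regressor_covariate.
apply: (measurableT_comp (measurable_tnth l)).
by apply: measurableT_comp.
Qed.

(** The quadratic form of [E[ZZ']] is [E[D^2] = P(D = 1)] at the basis vector of the treatment, and
    [E[(1 - D)^2] = P(D = 0)] at the intercept vector minus the treatment vector. Both must be
    positive. *)
Lemma treatment_prob_neq0 b :
  positive_definite (mexpectation P (fun w => Z w *m (Z w)^T)) ->
  P (D @^-1` [set b]) != 0%E.
Proof.
move=> [_ pos].
set M := mexpectation _ _ in pos.
pose i0 : 'I_(1 + (1 + k)) := lshift (1 + k) ord0.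
pose i1 : 'I_(1 + (1 + k)) := rshift 1 (lshift k ord0).
have ME i j : M i j = fine ('E_P[(fun w => (Z w i 0 * Z w j 0)%R)])%E.
  rewrite mxE; congr (fine ('E_P[_])%E); apply/funext => w.
  by rewrite mxE big_ord1 [(_^T) _ _]mxE.
pose q := fine (P (D @^-1` [set true])).
(* Since [D] is an indicator, [D^2 = D], so the treatment-treatment and treatment-intercept entries
   all equal [q]. *)
have EDE (f : T -> R) : f =1 (fun w => (D w)%:R) -> fine ('E_P[f])%E = q.
  move=> fD; transitivity (fine ('E_P[\1_(D @^-1` [set true])])%E); last first.
    by rewrite expectation_indic//; exact: measurable_event.
  congr (fine ('E_P[_])%E); apply/funext => w; rewrite fD indicE.
  by congr (nat_of_bool _)%:R; apply/idP/idP; rewrite inE.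
have M11 : M i1 i1 = q.
  by rewrite ME EDE// => w; rewrite regressor_treatment -natrM mulnb andbb.
have M01 : M i0 i1 = q.
  by rewrite ME EDE// => w; rewrite regressor1 regressor_treatment mul1r.
have M10 : M i1 i0 = q.
  by rewrite ME EDE// => w; rewrite regressor1 regressor_treatment mulr1.
have M00 : M i0 i0 = 1.
  rewrite ME (_ : (fun _ => _) = cst 1) ?expectation_cst//.
  by apply/funext => w; rewrite !regressor1 mulr1.
have quad i j :
    ((delta_mx i (0 : 'I_1))^T *m M *m delta_mx j (0 : 'I_1)) 0 0 = M i j.
  by rewrite trmx_delta -rowE -colE !mxE.
have i10 : i1 != i0 by [].
case: b.
  have : delta_mx i1 0 != 0 :> 'cV[R]_(1 + (1 + k)).
    by apply/negP => /eqP/matrixP/(_ i1 0); rewrite !mxE !eqxx => /eqP;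
      rewrite oner_eq0.
  move/pos; rewrite quad M11; apply: contraTneq => q0.
  by rewrite /q q0 ltxx.
have : delta_mx i0 0 - delta_mx i1 0 != 0 :> 'cV[R]_(1 + (1 + k)).
  apply/negP => /eqP/matrixP/(_ i0 0); rewrite !mxE !eqxx eq_sym (negbTE i10)/=.
  by rewrite subr0 => /eqP; rewrite oner_eq0.
have subE (A B : 'M[R]_1) : (A - B) 0 0 = A 0 0 - B 0 0 by rewrite !mxE.
have trB (u v : 'cV[R]_(1 + (1 + k))) : (u - v)^T = u^T - v^T by rewrite linearB.
move/pos; rewrite mulmxBr trB !mulmxBl !subE !quad M00 M01 M10 M11.
rewrite subrr subr0; apply: contraTneq => q0.
have -> : q = 1.
  rewrite /q -[D @^-1` _]setCK probability_setC; last first.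
    by apply: measurableC; exact: measurable_event.
  rewrite (_ : ~` _ = D @^-1` [set false]) ?q0 ?sube0//.
  by apply/seteqP; split=> w /=; case: (D w).
by rewrite subrr ltxx.
Qed.

End regressor.

(** * Integrability from moment bounds on the Euclidean norm *)

Section moments.
Context {d} {T : measurableType d} {R : realType}.
Variable P : probability T R.

Lemma integrable_expectation_le (f h : T -> R) :
    measurable_fun setT f -> measurable_fun setT h ->
    (forall w, `|f w| <= h w) -> ('E_P[h] < +oo)%E ->
  P.-integrable setT (EFin \o f).
Proof.
move=> mf mh fh hoo; apply/integrableP; split; first exact/measurable_EFinP.
apply: le_lt_trans hoo; rewrite unlock.
apply: ge0_le_integral => //; last by move=> w _; rewrite lee_fin.
  by apply: measurableT_comp => //; exact/measurable_EFinP.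
exact/measurable_EFinP.
Qed.

Lemma coord_le_enorm {n} (v : 'cV[R]_n) i : `|v i 0| <= enorm v.
Proof.
rewrite -sqrtr_sqr ler_sqrt; last by apply: sumr_ge0 => j _; exact: sqr_ge0.
by rewrite (bigD1 i)//= lerDl; apply: sumr_ge0 => j _; exact: sqr_ge0.
Qed.

Lemma measurable_enorm {n} (V : T -> 'cV[R]_n) :
    (forall i, measurable_fun setT (fun w => V w i 0)) ->
  measurable_fun setT (fun w => enorm (V w)).
Proof.
move=> mV.
have msqrt : measurable_fun setT (@Num.sqrt R).
  by apply: continuous_measurable_fun; exact: sqrt_continuous.
apply: (measurableT_comp msqrt).
by apply: measurable_sum => i; exact: measurable_funX.
Qed.

Lemma integrable_coord {n} (V : T -> 'cV[R]_n) i :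
    (forall i, measurable_fun setT (fun w => V w i 0)) ->
    ('E_P[fun w => enorm (V w)] < +oo)%E ->
  P.-integrable setT (fun w => (V w i 0)%:E).
Proof.
move=> mV; apply: integrable_expectation_le; [exact: mV| |].
  exact: measurable_enorm.
by move=> w; exact: coord_le_enorm.
Qed.

End moments.

(** * The mean of [Y] given [D = b] as an average of kernel means *)

Section conditional_mean.
Context {d} {T : measurableType d} {R : realType} {d'} {U : measurableType d'}.
Variables (P : probability T R) (D : {RV P >-> bool}) (b : bool).
Variables (X : {RV P >-> U}) (Y : {RV P >-> R}).
Variables (dom : set U) (F : U * bool -> probability R R).
Hypothesis Db0 : P (D @^-1` [set b]) != 0%E.
Hypothesis mdom : measurable dom.
Hypothesis lawF : cond_law_on (dom `*` [set: bool]) F Y (pair_RV X D).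
Hypothesis intY : P.-integrable setT (EFin \o Y).

Local Notation G := (cond_distribution D X b).
Local Notation Pb := (cond_prob D b).

Let mFb B (mB : measurable B) : measurable_fun dom (fun x => F (x, b) B) :=
  cond_law_on_measurable _ _ _ _ _ mdom lawF _ b mB.

(** Disintegration covers nonnegative integrands only, so the positive and negative parts of [Y] are
    handled separately. Finiteness of the integral over [Pb] makes the kernel integral
    [G]-integrable, which legitimates the later subtraction. *)
Let nonneg_part (h : R -> \bar R) : (forall y, (0 <= h y)%E) ->
    measurable_fun setT h -> Pb.-integrable setT (h \o Y) ->
  G.-integrable dom (fun x => \int[F (x, b)]_y h y)%E /\
  (\int[G]_(x in dom) \int[F (x, b)]_y h y = \int[Pb]_w h (Y w))%E.
Proof.
move=> h0 mh inth.
have E : (\int[G]_(x in dom) \int[F (x, b)]_y h y = \int[Pb]_w h (Y w))%E.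
  rewrite -(disintegration _ _ (fun x => F (x, b)) mdom mFb _ h0 mh
    (distribution Pb Y)); last first.
    by move=> B mB; exact: cond_law_cond_prob.
  by rewrite ge0_integral_pushforward.
split=> //; apply/integrableP; split.
  exact: measurable_integral_on_kernel.
under eq_integral do rewrite gee0_abs ?integral_ge0//.
by rewrite E; exact: integrable_lty.
Qed.

Let intYb : Pb.-integrable setT (EFin \o Y) := integrable_cond_prob _ _ _ Db0 _ intY.

Let pos : G.-integrable dom (fun x => \int[F (x, b)]_y EFin^\+ y)%E /\
  (\int[G]_(x in dom) \int[F (x, b)]_y EFin^\+ y =
   \int[Pb]_w EFin^\+ (Y w))%E.
Proof.
by apply: nonneg_part => //; [exact: measurable_funepos|
  by rewrite -funepos_comp; exact: integrable_funepos].
Qed.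

Let neg : G.-integrable dom (fun x => \int[F (x, b)]_y EFin^\- y)%E /\
  (\int[G]_(x in dom) \int[F (x, b)]_y EFin^\- y =
   \int[Pb]_w EFin^\- (Y w))%E.
Proof.
by apply: nonneg_part => //; [exact: measurable_funeneg|
  by rewrite -funeneg_comp; exact: integrable_funeneg].
Qed.

Let cond_meanE : (fun x => cond_mean F (x, b)) =
  (fun x => \int[F (x, b)]_y EFin^\+ y - \int[F (x, b)]_y EFin^\- y)%E.
Proof. by apply/funext => x; rewrite /cond_mean integralE. Qed.

Lemma integrable_cond_mean : G.-integrable dom (fun x => cond_mean F (x, b)).
Proof. by rewrite cond_meanE; exact: (integrableB mdom pos.1 neg.1). Qed.

Lemma integral_cond_mean :
  (\int[G]_(x in dom) cond_mean F (x, b) = 'E_Pb[Y])%E.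
Proof.
rewrite cond_meanE (integralB mdom pos.1 neg.1) pos.2 neg.2.
by rewrite expectation_def [RHS](integralE _ _ (EFin \o Y))
  (funepos_comp EFin Y) (funeneg_comp EFin Y).
Qed.

End conditional_mean.

(** * The bias formula for the regression coefficient *)

Theorem proposition1 (d : measure_display) (T : measurableType d)
    (R : realType) (P : probability T R) (p k : nat)
    (Y : {RV P >-> R}) (X : {RV P >-> p.-tuple R}) (D : {RV P >-> bool})
    (mu : {sigma_finite_measure set (p.-tuple R) -> \bar R})
    (g : bool -> p.-tuple R -> R)
    (F : p.-tuple R * bool -> probability R R)
    (s : {mfun p.-tuple R >-> k.-tuple R})
    (alpha beta : R) (gamma : 'cV[R]_k) (E : {RV P >-> R})
    (Z := fun w => regressor s (X w) (D w))
    (G := cond_distribution D X)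
    (XX := covariate_support X D)
    (f := fun x b => cond_mean F (x, b))
    (mu_dom : forall b, G b `<< mu)
    (gE : forall b, RN_version (G b) mu (g b))
    (F_law : cond_law_on (XX `*` [set: bool]) F Y (pair_RV X D))
    (tau_defined : (G true).-integrable XX (fun x => f x false))
    (model : forall w, Y w = linpred s alpha beta gamma (X w) (D w) + E w)
    (Z2_fin : ('E_P[(fun w => enorm (Z w) ^+ 2)%R] < +oo)%E)
    (ZE_fin : ('E_P[(fun w => enorm (E w *: Z w))%R] < +oo)%E)
    (ZZ_pos : positive_definite (mexpectation P (fun w => Z w *m (Z w)^T)))
    (ZE_0 : mexpectation P (fun w => E w *: Z w) = 0) :
  (beta%:E - tau Y X D F =
    \int[mu]_(x in XX)
      ((f x false - (linpred s alpha beta gamma x false)%:E) *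
       (g true x - g false x)%:E))%E /\
  (forall A : set (p.-tuple R), measurable A ->
    (\int[mu]_(x in A) (g true x - g false x)%:E = G true A - G false A)%E).
Proof.
pose i0 : 'I_(1 + (1 + k)) := lshift (1 + k) ord0.
pose i1 : 'I_(1 + (1 + k)) := rshift 1 (lshift k ord0).
have mZ i : measurable_fun setT (fun w => Z w i 0).
  exact: measurable_regressor.
(* The first entry of [Z] is 1, so its norm is at least 1 and is bounded by its own square, whose
   mean is finite. *)
have intZ i : P.-integrable setT (fun w => (Z w i 0)%:E).
  apply: (integrable_expectation_le P _ (fun w => enorm (Z w) ^+ 2)) => //.
    exact/measurable_funX/measurable_enorm.
  move=> w; apply: le_trans (coord_le_enorm _ i) _.
  have : `|Z w i0 0| <= enorm (Z w) by exact: coord_le_enorm.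
  rewrite regressor1 normr1 => e1.
  by rewrite expr2 ler_peMl// (le_trans ler01).
have intZE i : P.-integrable setT (fun w => ((E w *: Z w) i 0)%:E).
  apply: integrable_coord => // j.
  by under eq_fun do rewrite mxE; exact: measurable_funM.
(* A zero value of [fine] could also come from an infinite integral; [intZE] excludes that. *)
have ZE0 i : (\int[P]_w ((E w *: Z w) i 0)%:E = 0)%E.
  have /matrixP/(_ i 0) := ZE_0; rewrite [LHS]mxE [RHS]mxE unlock => fine0.
  by rewrite -[LHS]fineK ?fine0//; exact: integrable_fin_num.
have EE w : (E w *: Z w) i0 0 = E w by rewrite mxE regressor1 mulr1.
have EDE w : (E w *: Z w) i1 0 = E w * (D w)%:R.
  by rewrite mxE regressor_treatment.
have intE : P.-integrable setT (fun w => (E w)%:E).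
  by apply: eq_integrable (intZE i0) => // w _; rewrite EE.
have intED : P.-integrable setT (fun w => (E w * (D w)%:R)%:E).
  by apply: eq_integrable (intZE i1) => // w _; rewrite EDE.
have E0 : (\int[P]_w (E w)%:E = 0)%E.
  by rewrite -[RHS](ZE0 i0); apply: eq_integral => w _; rewrite EE.
have ED0 : (\int[P]_w (E w * (D w)%:R)%:E = 0)%E.
  by rewrite -[RHS](ZE0 i1); apply: eq_integral => w _; rewrite EDE.
have memD b w : (w \in D @^-1` [set b]) = (D w == b).
  by apply/idP/eqP; rewrite inE.
(* [E] restricted to [D = 1] is [E D], and restricted to [D = 0] it is [E - E D]; both have mean
   zero by the first two normal equations. *)
have Db_E b : (\int[P]_(w in D @^-1` [set b]) (E w)%:E = 0)%E.
  rewrite integral_mkcond; case: b.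
    rewrite -[RHS]ED0; apply: eq_integral => w _; rewrite patchE memD.
    by case: (D w); rewrite /= ?mulr1 ?mulr0.
  transitivity (\int[P]_w ((E w)%:E - (E w * (D w)%:R)%:E))%E.
    apply: eq_integral => w _; rewrite patchE memD.
    by case: (D w); rewrite /= ?mulr1 ?mulr0 ?sube0// subee.
  by rewrite integralB_EFin// E0 ED0 sube0.
have Db0 b : P (D @^-1` [set b]) != 0%E by exact: (treatment_prob_neq0 P X D s).
have cond_E b : (\int[cond_prob D b]_w (E w)%:E = 0)%E.
  by rewrite integral_cond_prob// Db_E mule0.
pose l0 x := linpred s alpha beta gamma x false.
have l0E x : l0 x = alpha + \sum_(j < k) tnth (s x) j * gamma j 0.
  rewrite /l0 /linpred mulr0 addr0 mxE; congr (_ + _).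
  by apply: eq_bigr => j _; rewrite !mxE.
have ml0 : measurable_fun setT l0.
  rewrite (_ : l0 = fun x => alpha + \sum_(j < k) tnth (s x) j * gamma j 0);
    last exact/funext.
  apply: measurable_funD; first exact: measurable_cst.
  apply: measurable_sum => j.
  apply: measurable_funM; last exact: measurable_cst.
  by apply: (measurableT_comp (measurable_tnth j)); exact: measurable_funP.
(* [l0 (X w)] is a constant plus a linear combination of the covariate entries of [Z], each
   integrable by [intZ]. *)
have intl0X : P.-integrable setT (fun w => (l0 (X w))%:E).
  rewrite (_ : (fun _ => _) = (fun w => alpha%:E + \sum_(j < k)
      ((gamma j 0)%:E * (Z w (rshift 1 (rshift 1 j)) 0)%:E))%E); last first.
    apply/funext => w; rewrite l0E EFinD -sumEFin; congr (_ + _)%E.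
    by apply: eq_bigr => j _; rewrite regressor_covariate mulrC EFinM.
  apply: integrableD => //; first exact: finite_measure_integrable_cst.
  by apply: integrable_sum => // j _; exact: integrableZl.
have intD : P.-integrable setT (fun w => ((D w)%:R)%:E).
  by apply: eq_integrable (intZ i1) => // w _; rewrite regressor_treatment.
have YE w : Y w = l0 (X w) + beta * (D w)%:R + E w.
  by rewrite model /l0 /linpred mulr0 addr0 [_ + _ + (_ *m _) _ _]addrAC.
have intY : P.-integrable setT (EFin \o Y).
  rewrite (_ : EFin \o Y = (fun w => (l0 (X w))%:E + beta%:E * ((D w)%:R)%:E
    + (E w)%:E)%E); last by apply/funext => w /=; rewrite YE.
  by apply: integrableD => //; apply: integrableD => //; exact: integrableZl.
have mXX : measurable XX by apply: measurableU; exact: measurable_support_of.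
have GXX b : G b (~` XX) = 0%E.
  apply/eqP; rewrite eq_le measure_ge0 andbT -(setC_support_of0 (G b)).
  apply: le_measure; rewrite ?inE; try exact: measurableC.
    by apply: measurableC; exact: measurable_support_of.
  by apply: subsetC; case: b => x; [right|left].
have intl0 b : (G b).-integrable setT (EFin \o l0).
  apply: integrable_pushforward => //; first exact/measurable_EFinP.
  exact: integrable_cond_prob.
have intl0XX b : (G b).-integrable XX (EFin \o l0).
  exact: integrableS (intl0 b).
have Gl0 b : (\int[G b]_(x in XX) (l0 x)%:E =
    \int[cond_prob D b]_w (l0 (X w))%:E)%E.
  transitivity (\int[G b]_x (l0 x)%:E)%E.
    rewrite (@negligible_integral _ _ _ (G b) setT (~` XX))//.
    - by rewrite setTD setCK.
    - exact: measurableC.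
    - exact: intl0.
    - exact: GXX.
  apply: integral_pushforward => //; first exact/measurable_EFinP.
  exact: integrable_cond_prob.
(* Averaging the model over [D = b]: the error drops out by [cond_E] and the treatment term is the
   constant [beta * b]. *)
have cond_Y b : ('E_(cond_prob D b)[Y] =
    \int[G b]_(x in XX) (l0 x)%:E + (beta * b%:R)%:E)%E.
  have intc : P.-integrable setT (cst (beta * b%:R)%:E).
    exact: finite_measure_integrable_cst.
  have intlc := integrableD measurableT intl0X intc.
  rewrite expectation_def integral_cond_prob//.
  rewrite (_ : integral P _ _ = \int[P]_(w in D @^-1` [set b])
      ((l0 (X w))%:E + (beta * b%:R)%:E + (E w)%:E))%E; last first.
    by apply: eq_integral => w; rewrite memD YE => /eqP ->.
  rewrite -integral_cond_prob//; last exact: integrableD.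
  rewrite integralD//=; try exact: integrable_cond_prob.
  rewrite cond_E adde0 integralD//; try exact: integrable_cond_prob.
  rewrite Gl0 integral_cst//=.
  by rewrite (_ : cond_prob D b setT = 1%E) ?mule1//; exact: probability_setT.
(* For [b = 1] this is the assumption that [tau] is well defined; for [b = 0] it follows from the
   integrability of [Y]. *)
have intf b : (G b).-integrable XX (fun x => f x false).
  case: b => //.
  exact: (integrable_cond_mean P D false X Y XX F (Db0 false) mXX F_law intY).
have intfl b : (G b).-integrable XX (fun x => f x false - (l0 x)%:E)%E.
  exact: (integrableB mXX (intf b) (intl0XX b)).
split.
  rewrite (integral_RN_version_diff G mu g XX) //.
  rewrite (integralB mXX (intf true) (intl0XX true)).
  rewrite (integralB mXX (intf false) (intl0XX false)).
  (* Both integrals equal [E[Y | D = 0]], one through the kernel and one through the model, so the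
     [G false] part of the right-hand side cancels. *)
  have -> : (\int[G false]_(x in XX) f x false =
      \int[G false]_(x in XX) (l0 x)%:E)%E.
    transitivity ('E_(cond_prob D false)[Y])%E; last by rewrite cond_Y mulr0 adde0.
    exact: integral_cond_mean (Db0 false) mXX F_law intY.
  have l_fin b := integrable_fin_num mXX (intl0XX b).
  rewrite (subee (l_fin false)) sube0 /tau cond_Y mulr1.
  rewrite -/(f _ false) -/XX -/(G true).
  (* All remaining terms are finite, so the identity reduces to real arithmetic. *)
  rewrite -(fineK (l_fin true)) -(fineK (integrable_fin_num mXX (intf true))).
  by rewrite -EFinD -!EFinB; congr EFin; lra.
move=> A mA.
(* The identification of the signed measure is the same change of variables with integrand 1. *)
have := integral_RN_version_diff G mu g A (cst 1%E) mu_dom gE mA.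
rewrite !integral_cst// !mul1e => <-.
  by apply: eq_integral => x _; rewrite mul1e.
by move=> b; exact: finite_measure_integrable_cst.
Qed.
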